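(* Let $d\in\mathbb{N}$, $-1<q<1$, and let $A_1,\dots,A_d$ be the $q$-Gaussians on $\mathcal{F}_q(H)$, $\dim H=d$. For $i\in[d]$ define a densely defined unbounded operator $D_i$ with domain $\mathcal{F}_{\mathrm{alg}}(H)$ by linear extension of $$D_ie_0=0,\qquad D_ie_{j_n\cdots j_1}=\sum_{\pi\in B(n+1)}(-1)^{\pi(0)-1}q^{\mathrm{cross}(\pi)}\,\delta_{p(\pi)}\,e_{s(\pi)}\qquad(n\ge1,\ j_1,\dots,j_n\in[d]),$$ where $\delta_{p(\pi)}=\prod_{(k,l)\in p(\pi)}\delta_{j_kj_l}$ with $j_0:=i$, and $e_{s(\pi)}=e_{j_{k_s}\cdots j_{k_1}}$ for $s(\pi)=\{k_s>\cdots>k_1\}$ (and $e_{s(\pi)}=e_0$ if $s(\pi)=\emptyset$). Then for all $i,j\in[d]$ $$[D_i,A_j]=\delta_{ij}P^{(0)}$$ on the domain $\mathcal{F}_{\mathrm{alg}}(H)$, where $P^{(0)}$ denotes the orthogonal projection onto $\mathbb{C}e_0$.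
   Context: **$q$-Gaussians.** Let $-1<q<1$, $[d]=\{1,\dots,d\}$, and let $H$ be a $d$-dimensional complex Hilbert space with orthonormal basis $e_1,\dots,e_d$. Let $[d]^*$ be the set of finite words in $[d]$ (empty word denoted $0$). The algebraic Fock space is $\mathcal{F}_{\mathrm{alg}}(H)=\bigoplus_{n\ge0}H^{\otimes n}$ (algebraic direct sum), $H^{\otimes0}=\mathbb{C}e_0$, with linear basis $e_w=e_{w_1}\otimes\cdots\otimes e_{w_n}$, $w=w_1\cdots w_n\in[d]^*$. The inner product $\langle\xi,\eta\rangle_q=\langle\xi,\bigoplus_nT_n\eta\rangle$, with $T_ne_w=\sum_{\pi\in S_n}q^{|\pi|}e_{w_{\pi(1)}\cdots w_{\pi(n)}}$ for $|w|=n$ and $|\pi|$ the number of inversions, is strictly positive; $\mathcal{F}_q(H)$ is the completion. The $q$-Gaussians are $A_i=l_i+l_i^*$ with $l_i^*e_w=e_{iw}$ and $l_i$ the adjoint of $l_i^*$, given by $l_ie_0=0$, $l_ie_{j_n\cdots j_1}=\sum_{k=1}^nq^{n-k}\delta_{ij_k}e_{j_n\cdots\check{j_k}\cdots j_1}$ ($\check{j_k}$ means omitted). **The partitions $B(n+1)$.** For $n\ge1$, $B(n+1)$ is the set of partitions $\pi$ of the $n+1$ vertices $n>n-1>\cdots>1>0$ into pairs and singletons such that: $0$ is paired with some $k\in\{1,\dots,n\}$, written $k=\pi(0)$; every $l\in\{1,\dots,k-1\}$ is paired with some element of $\{k+1,\dots,n\}$; all remaining vertices (those in $\{k+1,\dots,n\}$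 not paired with an element of $\{1,\dots,k-1\}$) are singletons. $p(\pi)$ is the set of pairs and $s(\pi)$ the set of singletons of $\pi$. **Crossings.** The vertices are drawn on a horizontal line in the order $n,n-1,\dots,0$ from left to right. A pair with smaller element $l$ (where $0\le l\le k-1$) is drawn with height $l+1$: vertical segments go up from both of its vertices to height $l+1$ and are joined by a horizontal segment at height $l+1$. A singleton is drawn as a vertical line going to the top (above all heights). $\mathrm{cross}(\pi)$ is the number of crossings in this drawing. Equivalently, let $h(x)=l+1$ if $x$ belongs to the pair with smaller element $l$, and $h(x)=\infty$ if $x$ is a singleton; then $\mathrm{cross}(\pi)=\sum_{\{l<r\}\in p(\pi)}\#\{x:\ l<x<r,\ h(x)>h(l)\}$. For example, $\pi=\{(0,3),(1,5),(2,4)\}\in B(6)$ has $\mathrm{cross}(\pi)=4$. *)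

(* Defs.v *)
From HB Require Import structures.
From mathcomp Require Import all_boot all_order all_algebra all_fingroup.
From mathcomp Require Import complex freeg.
From mathcomp Require Import all_classical all_reals all_analysis.

Set Implicit Arguments.
Unset Strict Implicit.
Unset Printing Implicit Defensive.

Import Order.TTheory GRing.Theory Num.Theory.
Import numFieldNormedType.Exports.

Local Open Scope ring_scope.
Local Open Scope complex_scope.

(* Letters are 'I_d = {0, .., d - 1} in place of {1, .., d}.  After the choice
   of the orthonormal basis of H, the algebraic Fock space is the free vector
   space on words; the word j_n ... j_1 is the list [:: j_n; ...; j_1]. *)
Definition fock (R : realType) (d : nat) := {freeg (seq 'I_d) / R[i]}.

Section Fock.
Context {R : realType} {d : nat}.
Implicit Types (q : R) (w : seq 'I_d) (xi eta : fock R d).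

Definition fock_e w : fock R d := Freeg [:: (1, w)].

(* Linear in the first argument, as in [{dot _ for _}]. *)
Definition free_dot xi eta : R[i] :=
  \sum_(w <- dom xi) coeff w xi * (coeff w eta)^*.

Definition inversions n (s : 'S_n) : nat :=
  #|[set ab : 'I_n * 'I_n | (ab.1 < ab.2)%N && (s ab.2 < s ab.1)%N]%SET|.

Definition permute_word w (s : 'S_(size w)) : seq 'I_d :=
  [seq tnth (in_tuple w) (s a) | a <- enum 'I_(size w)].

Definition q_symm q : fock R d -> fock R d :=
  fglift (fun w => \sum_(s : 'S_(size w))
    q%:C ^+ inversions s *: fock_e (permute_word s)).

Definition q_dot q xi eta : R[i] := free_dot xi (q_symm q eta).

End Fock.

(* A set partition of the vertices 0, .., n is a [{set {set 'I_n.+1}}]. *)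
Section Partitions.
Context {n : nat}.
Implicit Types (P : {set {set 'I_n.+1}}) (k l m x : 'I_n.+1).

Definition paired P l m : bool := (l != m) && ([set l; m]%SET \in P).
Definition singleton P x : bool := [set x]%SET \in P.

(* The set B(n+1). *)
Definition Bpart : {set {set {set 'I_n.+1}}} :=
  [set P : {set {set 'I_n.+1}} |
    [&& finset.partition P [set: 'I_n.+1]%SET,
               [forall b in P, #|b| <= 2]%N &
    [exists k : 'I_n.+1,
      [&& (0 < k)%N, paired P ord0 k,
          [forall l : 'I_n.+1, (0 < l < k)%N ==>
             [exists m : 'I_n.+1, (k < m)%N && paired P l m]] &
          [forall m : 'I_n.+1, (k < m)%N ==>
             (singleton P m
              || [exists l : 'I_n.+1, (0 < l < k)%N && paired P l m])]]]]]%SET.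

Definition partner0 P : nat :=
  if [pick k | paired P ord0 k] is Some k then k : nat else 0%N.

(* A pair has height at most n, since its smaller element is at most n - 1,
   so n + 1 serves as the infinite height of the singletons. *)
Definition height P x : nat :=
  if singleton P x then n.+1
  else [arg min_(y < x in finset.pblock P x) (y : nat)].+1.

Definition cross P : nat :=
  \sum_(lr : 'I_n.+1 * 'I_n.+1 | (lr.1 < lr.2)%N && paired P lr.1 lr.2)
    #|[set x : 'I_n.+1 | (lr.1 < x < lr.2)%N
                         && (height P lr.1 < height P x)%N]%SET|.

End Partitions.

Section Operators.
Context {R : realType} {d : nat}.
Implicit Types (q : R) (w : seq 'I_d) (i : 'I_d).

(* For w = [:: j_n; ...; j_1], this is j_x, where j_0 := i. *)
Definition letter i w (x : nat) : 'I_d := nth i (i :: rev w) x.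

Definition delta_pairs i w (P : {set {set 'I_(size w).+1}}) : R[i] :=
  \prod_(lr : 'I_(size w).+1 * 'I_(size w).+1
         | (lr.1 < lr.2)%N && paired P lr.1 lr.2)
    (letter i w lr.1 == letter i w lr.2)%:R.

(* [enum] lists the vertices increasingly, the word reads them decreasingly. *)
Definition singleton_word i w (P : {set {set 'I_(size w).+1}}) : seq 'I_d :=
  rev [seq letter i w (val x) | x <- enum 'I_(size w).+1 & singleton P x].

Definition D_basis q i w : fock R d :=
  if w is [::] then 0 else
  \sum_(P in @Bpart (size w))
    ((-1) ^+ (partner0 P).-1 * q%:C ^+ cross P * delta_pairs i P)
      *: fock_e (singleton_word i P).

(* D_i maps F_alg to itself; as an unbounded operator on the completion its
   domain is the range of the embedding. *)
Definition D q i : fock R d -> fock R d := fglift (D_basis q i).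

End Operators.

Section Completion.
(* F_q(H) is any Hilbert space (F, dot) with a dense isometric embedding iota
   of F_alg; this determines it up to a unique unitary compatible with iota. *)
Context {R : realType} {d : nat} {F : completeNormedModType R[i]}.
Implicit Types (dot : F -> F -> R[i]) (iota : fock R d -> F).

Definition induces_norm dot := forall x : F, `|x| ^+ 2 = dot x x.

(* Injectivity of the embedding amounts to strict positivity of [q_dot q]. *)
Definition is_completion (q : R) dot iota :=
  [/\ injective iota,
      forall xi eta, dot (iota xi) (iota eta) = q_dot q xi eta
    & dense (range iota)].

Definition is_creation iota (i : 'I_d) (c : F -> F) :=
  [/\ linear c, continuous c
    & forall w, c (iota (fock_e w)) = iota (fock_e (i :: w))].

Definition is_adjoint dot (c a : F -> F) :=
  forall x y, dot (a x) y = dot x (c y).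

Definition is_orthogonal_projection dot (S : set F) (P : F -> F) :=
  forall x, S (P x) /\ forall y, S y -> dot (x - P x) y = 0.

Definition line (v : F) : set F := range (fun c : R[i] => c *: v).

End Completion.

(* Main.v *)
Require Import Defs.
From HB Require Import structures.
From mathcomp Require Import all_boot all_order all_algebra all_fingroup.
From mathcomp Require Import complex freeg.
From mathcomp Require Import all_classical all_reals all_analysis.
From mathcomp Require Import ring.
Import Order.TTheory GRing.Theory Num.Theory.
Import numFieldNormedType.Exports.
Local Open Scope ring_scope.
Local Open Scope complex_scope.

Set Implicit Arguments.
Unset Strict Implicit.
Unset Printing Implicit Defensive.

(* Write A_j = L_j + C_j with C_j the left creation and L_j the left annihilation
   operator, and let R_b be the right annihilation operator, which removes a
   letter b with weight q to the number of letters on its right.  A partition in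
   B(n+1) with pi(0) = k is built by matching 0 with k and then 1, .., k - 1
   successively with free vertices above k; the pair of l crosses, above k,
   exactly the vertices that are still free to the right of its partner.  Hence
     D_i e_w = sum over w = u i v of
       (-1)^|v| q^(|v|(|v|+1)/2) R_v e_u,   R_v := R_{v_1} ... R_{v_m}.
   R_b commutes with L_j, whereas [R_b, C_j] = delta_bj q^N.  In [D_i, A_j] the
   terms in which L_j removes a letter j of v cancel against those in which C_j is
   commuted past the factor R_j of that letter.  What is left is the factorization
   of jw with u empty and v = w, namely delta_ij R_w e_0 up to a factor, which
   vanishes unless w is empty. *)

(** * Operators on the algebraic Fock space *)

Definition rm_nth (T : Type) (p : nat) (w : seq T) := take p w ++ drop p.+1 w.

Section FreeLift.
Context {R : nzRingType} {K : choiceType}.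
Implicit Types (M : lmodType R) (x : {freeg K / R}).

Fact fglift_linear M (f : K -> M) : linear (fglift f).
Proof.
have FB : {morph fglift f : y z / y - z} := lift_is_additive f.
have F0 : fglift f 0 = 0 by rewrite -(subrr 0) FB subrr.
have FD : {morph fglift f : y z / y + z}.
  by move=> y z; rewrite -{1}[z]opprK FB -[- z]sub0r FB F0 sub0r opprK.
move=> c x y; rewrite FD; congr (_ + _).
rewrite -{2}[x]freeg_sumE [c *: x]/(fgscale c x) /fgscale.
rewrite !(big_morph _ FD F0) scaler_sumr.
by apply: eq_bigr => k _; rewrite !liftU scalerA.
Qed.

HB.instance Definition _ M (f : K -> M) :=
  GRing.isLinear.Build R {freeg K / R} M *:%R (fglift f) (fglift_linear f).

End FreeLift.

Section Fock.
Context {R : realType} {d : nat}.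
Local Notation fk := (fock R d).
Implicit Types (xi : fk) (w : seq 'I_d).

Lemma fglift_e (M : lmodType R[i]) (f : seq 'I_d -> M) w :
  fglift f (fock_e w : fk) = f w.
Proof. by rewrite liftU scale1r. Qed.

Lemma fock_sumE xi : xi = \sum_(w <- dom xi) coeff w xi *: fock_e w.
Proof.
rewrite -{1}[xi]freeg_sumE; apply: eq_bigr => w _.
by apply/eqP/freeg_eqP => v; rewrite coeffZ !coeffU mul1r.
Qed.

Lemma fock_linear_ext (M : lmodType R[i]) (f g : {linear fk -> M}) :
  (forall w, f (fock_e w) = g (fock_e w)) -> f =1 g.
Proof.
move=> fg xi; rewrite [xi]fock_sumE !linear_sum.
by apply: eq_bigr => w _; rewrite !linearZ fg.
Qed.

Section Operators.
Context (q : R[i]).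

Definition lcreate (a : 'I_d) : fk -> fk := fglift (fun w => fock_e (a :: w)).
Definition rcreate (a : 'I_d) : fk -> fk := fglift (fun w => fock_e (rcons w a)).
Definition qnumber : fk -> fk := fglift (fun w => q ^+ size w *: fock_e w).
Definition lannih (j : 'I_d) : fk -> fk := fglift (fun w =>
  \sum_(p < size w) ((nth j w p == j)%:R * q ^+ p) *: fock_e (rm_nth p w)).
(** Recursion on the first letter rather than a sum over positions as in [lannih]; [rannih_lcreate]
    is then a matter of unfolding. *)
Fixpoint rannih_word (b : 'I_d) w : fk :=
  if w is a :: w' then
    ((a == b)%:R * q ^+ size w') *: fock_e w' + lcreate a (rannih_word b w')
  else 0.
Definition rannih (b : 'I_d) : fk -> fk := fglift (rannih_word b).
Fixpoint rannihs w xi : fk :=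
  if w is b :: w' then rannih b (rannihs w' xi) else xi.

HB.instance Definition _ a := GRing.Linear.on (lcreate a).
HB.instance Definition _ a := GRing.Linear.on (rcreate a).
HB.instance Definition _ := GRing.Linear.on qnumber.
HB.instance Definition _ a := GRing.Linear.on (lannih a).
HB.instance Definition _ a := GRing.Linear.on (rannih a).

Fact rannihs_linear w : linear (rannihs w).
Proof. by elim: w => //= a w IH c xi eta; rewrite IH linearP. Qed.
HB.instance Definition _ w :=
  GRing.isLinear.Build R[i] fk fk *:%R (rannihs w) (rannihs_linear w).

Lemma lcreate_e a w : lcreate a (fock_e w) = fock_e (a :: w).
Proof. exact: fglift_e. Qed.
Lemma rcreate_e a w : rcreate a (fock_e w) = fock_e (rcons w a).
Proof. exact: fglift_e. Qed.
Lemma qnumber_e w : qnumber (fock_e w) = q ^+ size w *: fock_e w.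
Proof. exact: fglift_e. Qed.
Lemma lannih_e j w : lannih j (fock_e w) =
  \sum_(p < size w) ((nth j w p == j)%:R * q ^+ p) *: fock_e (rm_nth p w).
Proof. exact: fglift_e. Qed.
Lemma rannih_e b w : rannih b (fock_e w) = rannih_word b w.
Proof. exact: fglift_e. Qed.

Lemma lcreate_rcreate a b xi :
  lcreate a (rcreate b xi) = rcreate b (lcreate a xi).
Proof.
apply: (@fock_linear_ext _ (lcreate a \o rcreate b) (rcreate b \o lcreate a)).
by move=> w /=; rewrite !(lcreate_e, rcreate_e).
Qed.

Lemma qnumber_lcreate a xi : qnumber (lcreate a xi) = q *: lcreate a (qnumber xi).
Proof.
apply: (@fock_linear_ext _ (qnumber \o lcreate a) (q \*: (lcreate a \o qnumber))).
move=> w /=; rewrite !(lcreate_e, qnumber_e) linearZ /= lcreate_e scalerA.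
by rewrite -exprS.
Qed.

Lemma qnumber_rcreate a xi : qnumber (rcreate a xi) = q *: rcreate a (qnumber xi).
Proof.
apply: (@fock_linear_ext _ (qnumber \o rcreate a) (q \*: (rcreate a \o qnumber))).
move=> w /=; rewrite !(rcreate_e, qnumber_e) linearZ /= rcreate_e scalerA.
by rewrite size_rcons -exprS.
Qed.

Lemma lannih_lcreate j a xi :
  lannih j (lcreate a xi) = (a == j)%:R *: xi + q *: lcreate a (lannih j xi).
Proof.
apply: (@fock_linear_ext _ (lannih j \o lcreate a)
  (((a == j)%:R \*: idfun) \+ (q \*: (lcreate a \o lannih j)))).
move=> w /=; rewrite lcreate_e !lannih_e big_ord_recl /= mulr1.
rewrite /rm_nth /= drop0; congr (_ + _).
rewrite linear_sum /= scaler_sumr; apply: eq_bigr => p _.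
by rewrite linearZ /= lcreate_e scalerA mulrCA -exprS.
Qed.

Lemma rannih_lcreate b a xi :
  rannih b (lcreate a xi) = (a == b)%:R *: qnumber xi + lcreate a (rannih b xi).
Proof.
apply: (@fock_linear_ext _ (rannih b \o lcreate a)
  (((a == b)%:R \*: qnumber) \+ (lcreate a \o rannih b))).
by move=> w /=; rewrite lcreate_e !rannih_e qnumber_e /= scalerA.
Qed.

Lemma lannih0 j : lannih j (fock_e [::]) = 0.
Proof. by rewrite lannih_e big_ord0. Qed.
Lemma rannih0 j : rannih j (fock_e [::]) = 0.
Proof. by rewrite rannih_e. Qed.
Lemma qnumber0 : qnumber (fock_e [::]) = fock_e [::].
Proof. by rewrite qnumber_e scale1r. Qed.

(** The step is asked for all vectors, not only for words, so that the commutation relations with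
    [lcreate] rewrite directly. *)
Lemma fock_ind (M : lmodType R[i]) (f g : {linear fk -> M}) :
  f (fock_e [::]) = g (fock_e [::]) ->
  (forall a xi, f xi = g xi -> f (lcreate a xi) = g (lcreate a xi)) -> f =1 g.
Proof.
move=> fg0 fgS; apply: fock_linear_ext; elim=> // a w IH.
by rewrite -lcreate_e; apply: fgS.
Qed.

Lemma qnumber_lannih j xi : lannih j (qnumber xi) = q *: qnumber (lannih j xi).
Proof.
apply: (@fock_ind _ (lannih j \o qnumber) (q \*: (qnumber \o lannih j))) => /=.
  by rewrite qnumber0 lannih0 linear0 scaler0.
move=> a eta /= IH; rewrite qnumber_lcreate linearZ /= !lannih_lcreate IH.
by rewrite !linearD !linearZ /= qnumber_lcreate !linearZ.
Qed.

Lemma qnumber_rannih j xi : rannih j (qnumber xi) = q *: qnumber (rannih j xi).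
Proof.
apply: (@fock_ind _ (rannih j \o qnumber) (q \*: (qnumber \o rannih j))) => /=.
  by rewrite qnumber0 rannih0 linear0 scaler0.
move=> a eta /= IH; rewrite qnumber_lcreate linearZ /= !rannih_lcreate IH.
by rewrite !linearD !linearZ /= qnumber_lcreate !linearZ.
Qed.

(** [lannih] weighs the letters to the left of the removed one, [rannih] those to the right. If
    [lannih] takes the letter further left, neither weight sees the other removal; otherwise
    whichever operator acts second loses one factor q. *)
Lemma lannih_rannih j b xi : lannih j (rannih b xi) = rannih b (lannih j xi).
Proof.
apply: (@fock_ind _ (lannih j \o rannih b) (rannih b \o lannih j)) => /=.
  by rewrite lannih0 rannih0 !linear0.
move=> a eta /= IH.
rewrite rannih_lcreate linearD linearZ /= !lannih_lcreate linearD !linearZ /=.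
rewrite rannih_lcreate IH qnumber_lannih !scalerDr.
rewrite addrCA; congr (_ + (_ + _)).
by rewrite !scalerA mulrC.
Qed.

(** The mirror image of [rannih_lcreate]: an appended letter has the whole word on its left, hence
    the weight q^N. *)
Lemma lannih_rcreate j a xi :
  lannih j (rcreate a xi) = rcreate a (lannih j xi) + (a == j)%:R *: qnumber xi.
Proof.
apply: (@fock_ind _ (lannih j \o rcreate a)
  ((rcreate a \o lannih j) \+ ((a == j)%:R \*: qnumber))) => /=.
  rewrite rcreate_e -lcreate_e lannih_lcreate lannih0 !linear0 addr0.
  by rewrite add0r qnumber0.
move=> b eta /= IH.
rewrite -lcreate_rcreate !lannih_lcreate IH qnumber_lcreate !linearD !linearZ /=.
rewrite lcreate_rcreate /= addrA; congr (_ + _).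
by rewrite !scalerA mulrC.
Qed.

Lemma lannih_rannihs j v xi : lannih j (rannihs v xi) = rannihs v (lannih j xi).
Proof. by elim: v => //= a v IH; rewrite lannih_rannih IH. Qed.

Lemma qnumber_rannihs v xi :
  rannihs v (qnumber xi) = q ^+ size v *: qnumber (rannihs v xi).
Proof.
elim: v => [|a v IH] /=; first by rewrite scale1r.
by rewrite IH linearZ /= qnumber_rannih scalerA -exprSr.
Qed.

Lemma rannihs0 v : rannihs v (fock_e [::]) = (v == [::])%:R *: fock_e [::].
Proof.
elim: v => [|a v IH] /=; first by rewrite scale1r.
by rewrite IH linearZ /= rannih0 scaler0 scale0r.
Qed.

End Operators.
End Fock.

Arguments rannihs : simpl nomatch.

(** * The commutator of the sum over factorizations *)

Section Splitting.
Context {R : realType} {d : nat} (q : R[i]).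
Local Notation fk := (fock R d).
Implicit Types (xi : fk) (w v : seq 'I_d) (i j a b : 'I_d) (G : seq 'I_d -> fk).

(** The action of [lannih] on the word that indexes a value, rather than on the value; see
    [fglift_lannih]. *)
Definition rm_sum j w G : fk :=
  \sum_(p < size w) ((nth j w p == j)%:R * q ^+ p) *: G (rm_nth p w).

Lemma rm_sum_cons j a w G :
  rm_sum j (a :: w) G =
  (a == j)%:R *: G w + q *: rm_sum j w (fun v => G (a :: v)).
Proof.
rewrite /rm_sum big_ord_recl /= mulr1 /rm_nth /= drop0; congr (_ + _).
by rewrite scaler_sumr; apply: eq_bigr => p _; rewrite scalerA mulrCA -exprS.
Qed.

Lemma eq_rm_sum j w G1 G2 :
  (forall v, size v = (size w).-1 -> G1 v = G2 v) ->
  rm_sum j w G1 = rm_sum j w G2.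
Proof.
move=> G12; apply: eq_bigr => p _; congr (_ *: _); apply: G12.
rewrite /rm_nth size_cat size_takel ?size_drop 1?ltnW //.
by rewrite subnS -subn1 addnBA ?subn_gt0 // subnKC 1?ltnW // subn1.
Qed.

Lemma rm_sumD j w G1 G2 :
  rm_sum j w (fun v => G1 v + G2 v) = rm_sum j w G1 + rm_sum j w G2.
Proof. by rewrite -big_split; apply: eq_bigr => p _; rewrite scalerDr. Qed.

Lemma rm_sum_linear (f : {linear fk -> fk}) j w G :
  rm_sum j w (fun v => f (G v)) = f (rm_sum j w G).
Proof. by rewrite linear_sum; apply: eq_bigr => p _; rewrite linearZ. Qed.

Lemma fglift_lannih G j w : fglift G (lannih q j (fock_e w)) = rm_sum j w G.
Proof.
by rewrite lannih_e linear_sum; apply: eq_bigr => p _; rewrite linearZ /= fglift_e.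
Qed.

(** When C_j moves to the left, a factor R_j at position p of v leaves q^N in its place; carrying
    q^N to the right end past |v| - 1 - p factors costs as many powers of q. The prefactor q^|v|
    turns this into q^(p + 1), so nothing is divided by q. *)
Lemma rannihs_lcreate v j xi :
  q ^+ size v *: rannihs q v (lcreate j xi) =
  q ^+ size v *: lcreate j (rannihs q v xi)
  + q *: rm_sum j v (fun u => rannihs q u (qnumber q xi)).
Proof.
elim: v => [|b v IH] /=.
  by rewrite [rm_sum _ _ _]big_ord0 scaler0 addr0.
have IHb := congr1 (rannih q b) IH.
rewrite linearD !linearZ /= rannih_lcreate in IHb.
rewrite exprS -!scalerA IHb.
rewrite rm_sum_cons rm_sum_linear qnumber_rannihs !scalerDr !scalerA.
rewrite -!addrA addrCA; congr (_ + (_ + _)).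
by rewrite [j == b]eq_sym; congr (_ *: _); ring.
Qed.

(* The exponent counts the crossings forced by |v| = m: with k = m + 1, the pair
   (0, k) crosses the m verticals of 1, .., m, and the pair of a vertex
   0 < l <= m crosses those of l + 1, .., m. *)
Definition split_weight (m : nat) : R[i] := (-1) ^+ m * q ^+ 'C(m.+1, 2).

Lemma split_weightS m : split_weight m.+1 = - (q ^+ m.+1 * split_weight m).
Proof.
by rewrite /split_weight binS bin1 exprD exprS mulN1r !mulNr; congr (- _); ring.
Qed.

(* The sum over the factorizations w = u i v of
   split_weight |v| *: R_v (xi with the letters of u appended on the right). *)
Fixpoint split_sum i w xi : fk :=
  if w is a :: w' then
    ((a == i)%:R * split_weight (size w')) *: rannihs q w' xi
    + split_sum i w' (rcreate a xi)
  else 0.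

Fact split_sum_linear i w : linear (split_sum i w).
Proof.
elim: w => [|a w IH] c xi eta /=; first by rewrite scaler0 addr0.
rewrite [rannihs _ _ _]linearP [rcreate _ _]linearP IH /=.
by rewrite !scalerDr addrACA !scalerA [c * _]mulrC.
Qed.
HB.instance Definition _ i w :=
  GRing.isLinear.Build R[i] fk fk *:%R (split_sum i w) (split_sum_linear i w).

(** Read xi as a prefix u already passed. The first two terms come from L_j applied to uw: a letter
    taken from w has u on its left, hence [qnumber]. The prefix must vary because [split_sum]
    appends the first letter of w to it. *)
Lemma split_sum_commutator i j w xi :
  split_sum i w (lannih q j xi)
  + rm_sum j w (fun v => split_sum i v (qnumber q xi))
  + split_sum i w (lcreate j xi)
  = lannih q j (split_sum i w xi) + lcreate j (split_sum i w xi).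
Proof.
elim: w xi => [|a w IH] xi /=.
  by rewrite [rm_sum _ _ _]big_ord0 !linear0 !addr0.
(* A removal behind a costs a factor q for passing a, which [qnumber] supplies once a belongs to the
   prefix. *)
have rest : q *: rm_sum j w (fun v => split_sum i v (rcreate a (qnumber q xi)))
    = rm_sum j w (fun v => split_sum i v (qnumber q (rcreate a xi))).
  rewrite -[LHS](rm_sum_linear (q \*: idfun)) /=.
  by apply: eq_rm_sum => v _; rewrite qnumber_rcreate linearZ.
(* The factorization in which a itself is the letter i: by [rannihs_lcreate] and the sign in
   [split_weightS], removing j from v amounts to minus the commutator of R_v and C_j. *)
have head : q *: rm_sum j w (fun v =>
      ((a == i)%:R * split_weight (size v)) *: rannihs q v (qnumber q xi))
    = ((a == i)%:R * split_weight (size w)) *: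
      (lcreate j (rannihs q w xi) - rannihs q w (lcreate j xi)).
  case: w {IH rest} => [|b w]; first by rewrite [rm_sum _ _ _]big_ord0 /= subrr !scaler0.
  (* All words left after a removal have the same length, hence the same weight. *)
  rewrite -(@eq_rm_sum _ _ (fun v => ((a == i)%:R * split_weight (size w)) *:
    rannihs q v (qnumber q xi))); last by move=> v /= ->.
  set c := (_ * split_weight (size w)).
  rewrite (rm_sum_linear (c \*: idfun)) /= scalerA [q * c]mulrC -[LHS]scalerA.
  have /eqP := rannihs_lcreate (b :: w) j xi.
  rewrite addrC -subr_eq => /eqP <-.
  rewrite split_weightS /= mulrN scaleNr -scalerN opprB.
  by rewrite -scalerBr scalerA; congr (_ *: _); rewrite /c; ring.
rewrite rm_sum_cons /= rm_sumD [q *: (_ + _)]scalerDr rest head.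
(* [lannih_rcreate] separates the removal of a from the extended prefix; it matches the term of
   [rm_sum] at position 0. *)
have IHa := IH (rcreate a xi).
rewrite lannih_rcreate linearD linearZ /= in IHa.
rewrite !linearD !linearZ /= lannih_rannihs.
rewrite -!lcreate_rcreate in IHa *.
rewrite [RHS]addrACA -IHa scalerN.
by rewrite [LHS](AC ((2*(1*(2*1)))*2) ((1*4)*(2*3*6*8)*(7*5))) /= subrr addr0.
Qed.
End Splitting.

(** * Creation and annihilation are adjoint *)

Section Inversions.

Lemma inversions_sum n (s : 'S_n) :
  inversions s = (\sum_(a < n) \sum_(b < n) ((a < b) && (s b < s a)))%N.
Proof.
rewrite /inversions -sum1_card pair_bigA big_mkcond /=.
by apply: eq_bigr => -[a b] _; rewrite inE /=; case: (_ && _).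
Qed.

(** The value 0 is taken at position k and forms an inversion with each of the k earlier
    positions. *)
Lemma inversions_lift_perm n (k : 'I_n.+1) (s : 'S_n) :
  inversions (lift_perm k ord0 s) = (k + inversions s)%N.
Proof.
rewrite !inversions_sum (bigD1_ord k) //= big1 => [|b _]; last first.
  by rewrite lift_perm_id ltn0 andbF.
rewrite add0n.
under eq_bigr => a _ do rewrite (bigD1_ord k) //= lift_perm_id lift_perm_lift.
rewrite big_split /=; congr addn.
  transitivity (\sum_(a < n) (a < k))%N.
    apply: eq_bigr => a _; congr (nat_of_bool _).
    by rewrite andbT ltnNge -[(k <= _)%N]/(k <= bump k a)%N leq_bump /unbump ltnn subn0 -ltnNge.
  rewrite -big_mkcond /= -(big_ord_widen _ (fun=> 1%N)) ?sum1_card ?card_ord //.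
  by rewrite -ltnS.
apply: eq_bigr => a _; apply: eq_bigr => b _; rewrite !lift_perm_lift.
by rewrite !ltnNge /= leq_bump2 negbK.
Qed.

(** A permutation is given by where it takes the value 0 and by its pattern on the other positions;
    injectivity of this encoding suffices by cardinality. *)
Lemma big_lift_perm (M : nmodType) n (F : 'S_n.+1 -> M) :
  \sum_s F s = \sum_(k < n.+1) \sum_(s : 'S_n) F (lift_perm k ord0 s).
Proof.
pose h (p : 'I_n.+1 * 'S_n) := lift_perm p.1 ord0 p.2.
have h_inj : injective h.
  move=> [k s] [k' s'] /= /permP E.
  have kk' : k = k'.
    apply: (@perm_inj _ (h (k, s))); rewrite [RHS]E /h /=.
    by rewrite !lift_perm_id.
  rewrite -kk' in E *; congr (_, _); apply/permP => x.
  by have := E (fintype.lift k x); rewrite /h /= !lift_perm_lift => /lift_inj.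
have h_bij : bijective h.
  by apply: inj_card_bij => //; rewrite card_prod card_ord !card_Sn factS.
by rewrite pair_bigA (reindex h) //; apply: onW_bij.
Qed.

End Inversions.

Section Insertion.
Context {T : eqType} (x0 : T).
Implicit Types (u v : seq T) (k : nat).

Lemma nth_insert u y k a : (k <= size u)%N ->
  nth x0 (take k u ++ y :: drop k u) (bump k a) = nth x0 u a.
Proof.
move=> ku; rewrite nth_cat (size_takel ku) /bump; case: (leqP k a) => ka.
  by rewrite add1n ltnNge leqW //= subSn //= nth_drop subnKC.
by rewrite /= add0n ka nth_take.
Qed.

Lemma insert_eqE u v y k : (k <= size u)%N -> size v = (size u).+1 ->
  (take k u ++ y :: drop k u == v) =
  (nth x0 v k == y) && (rm_nth k v == u).
Proof.
move=> ku uv; apply/eqP/andP => [<-|[/eqP <- /eqP <-]].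
  rewrite nth_cat size_takel // ltnn subnn /=; split=> //.
  rewrite /rm_nth take_size_cat ?size_takel // drop_cat size_takel // ltnNge leqnSn /=.
  by rewrite subSn // subnn /= drop0 cat_take_drop.
have kv : (k < size v)%N by rewrite uv.
have sk : size (take k v) = k by rewrite size_takel // ltnW.
by rewrite /rm_nth take_size_cat // drop_size_cat // -drop_nth // cat_take_drop.
Qed.

End Insertion.

Section Adjoint.
Context {R : realType} {d : nat} (q : R).
Local Notation fk := (fock R d).
Implicit Types (i j : 'I_d) (w v u : seq 'I_d) (xi eta : fk).

Lemma size_permute_word w (s : 'S_(size w)) : size (permute_word s) = size w.
Proof. by rewrite size_map size_enum_ord. Qed.

Lemma nth_permute_word j w (s : 'S_(size w)) (a : 'I_(size w)) :
  nth j (permute_word s) a = nth j w (s a).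
Proof. by rewrite (nth_map a) ?size_enum_ord // nth_ord_enum (tnth_nth j). Qed.

Lemma permute_word_cons j w (k : 'I_(size w).+1) (s : 'S_(size w)) :
  @permute_word d (j :: w) (lift_perm k ord0 s) =
  take k (permute_word s) ++ j :: drop k (permute_word s).
Proof.
have ku : (k <= size (permute_word s))%N by rewrite size_permute_word -ltnS.
apply: (@eq_from_nth _ j) => [|a].
  rewrite size_permute_word size_cat size_takel //= size_drop addnS subnKC //.
  by rewrite size_permute_word.
rewrite size_permute_word => aw; rewrite -[a]/(val (Ordinal aw)) nth_permute_word.
case: (unliftP k (Ordinal aw)) => [b ->|->]; last first.
  by rewrite lift_perm_id nth_cat size_takel // ltnn subnn.
by rewrite lift_perm_lift nth_insert // nth_permute_word.
Qed.

Lemma coeff_q_symm v w :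
  coeff v (q_symm q (fock_e w : fk)) =
  \sum_(s : 'S_(size w)) q%:C ^+ inversions s * (permute_word s == v)%:R.
Proof.
rewrite /q_symm fglift_e raddf_sum; apply: eq_bigr => s _.
by rewrite /= coeffZ coeffU mul1r.
Qed.

HB.instance Definition _ := GRing.Linear.on (@q_symm R d q).

Lemma coeff_linear_sum (f : {linear fk -> fk}) v eta :
  coeff v (f eta) = \sum_(w <- dom eta) coeff w eta * coeff v (f (fock_e w)).
Proof.
rewrite {1}[eta]fock_sumE linear_sum raddf_sum.
by apply: eq_bigr => w _; rewrite linearZ /= coeffZ.
Qed.

(** When the permutations in T e_(jw) are sorted by the position p where j lands, the inversions of
    j give q^p and the rest is T e_w. These are the weights of [lannih], whence the adjointness. *)
Lemma coeff_q_symm_lcreate j v eta :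
  coeff v (q_symm q (lcreate j eta)) =
  \sum_(p < size v) (nth j v p == j)%:R * q%:C ^+ p * coeff (rm_nth p v) (q_symm q eta).
Proof.
have key w : coeff v (q_symm q (fock_e (j :: w) : fk)) =
  \sum_(p < size v) (nth j v p == j)%:R * q%:C ^+ p
    * coeff (rm_nth p v) (q_symm q (fock_e w)).
  rewrite coeff_q_symm; under [RHS]eq_bigr do rewrite coeff_q_symm.
  (* T preserves length, so unless |v| = |w| + 1 both sides vanish. *)
  have [vw|vw] := eqVneq (size v) (size w).+1; last first.
    rewrite !big1 // => [p _|s _].
      rewrite big1 ?mulr0 // => s _; case: eqP => [E|]; last by rewrite mulr0.
      case/eqP: vw; rewrite -(size_permute_word s) E /rm_nth size_cat size_takel 1?ltnW //.
      by rewrite size_drop -addnS subnSK // subnKC // ltnW.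
    case: eqP => [E|]; last by rewrite mulr0.
    by rewrite -E size_permute_word eqxx in vw.
  rewrite vw big_lift_perm; apply: eq_bigr => k _; rewrite mulr_sumr.
  apply: eq_bigr => s _; rewrite inversions_lift_perm permute_word_cons.
  have kw : (k <= size (permute_word s))%N by rewrite size_permute_word -ltnS.
  rewrite (@insert_eqE _ j _ _ _ _ kw) ?size_permute_word //.
  by rewrite eq_sym -mulnb natrM exprD [rm_nth _ _ == _]eq_sym; ring.
rewrite (coeff_linear_sum (q_symm q \o lcreate j)) /=.
under eq_bigr do rewrite lcreate_e key mulr_sumr.
rewrite exchange_big; apply: eq_bigr => p _.
rewrite (coeff_linear_sum (q_symm q)) mulr_sumr.
by apply: eq_bigr => w _; rewrite mulrCA.
Qed.

Lemma free_dotE xi eta :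
  free_dot xi eta = fglift (fun w => (coeff w eta)^* : R[i]^o) xi.
Proof.
rewrite [in RHS](fock_sumE xi) linear_sum.
by apply: eq_bigr => w _; rewrite linearZ /= fglift_e.
Qed.

Lemma q_dot_lannih j xi eta :
  q_dot q (lannih q%:C j xi) eta = q_dot q xi (lcreate j eta).
Proof.
rewrite /q_dot !free_dotE.
apply: (@fock_linear_ext _ _ _ (fglift _ \o lannih q%:C j) (fglift _)) => v /=.
rewrite lannih_e linear_sum fglift_e coeff_q_symm_lcreate rmorph_sum.
apply: eq_bigr => p _; rewrite linearZ /= fglift_e !rmorphM rmorphXn rmorph_nat /=.
(* The weights pass through the conjugation because q is real. *)
by rewrite -[q -i* 0]/(q%:C^*) conjc_real.
Qed.

Lemma q_dot_e0 xi : q_dot q xi (fock_e [::]) = coeff [::] xi.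
Proof.
rewrite /q_dot free_dotE.
have T0 : q_symm q (fock_e [::] : fk) = fock_e [::].
  rewrite /q_symm fglift_e /=.
  have S0 (s : 'S_0) : s = 1%g by apply/permP => -[].
  rewrite (big_pred1 1%g) => [|s]; last by rewrite /= (S0 s) eqxx.
  rewrite inversions_sum big_ord0 scale1r; congr fock_e.
  by apply: size0nil; rewrite size_permute_word.
rewrite T0 [in RHS](fock_sumE xi) raddf_sum [in LHS](fock_sumE xi) linear_sum.
apply: eq_bigr => w _; rewrite linearZ /= fglift_e coeffZ; congr (_ * _).
by rewrite !coeffU !mul1r rmorph_nat eq_sym.
Qed.

End Adjoint.

(** * Partitions into pairs and singletons as involutions *)

Section Matchings.
Context {n : nat}.
Local Open Scope set_scope.
Implicit Types (P : {set {set 'I_n.+1}}) (g : 'S_n.+1) (k l m x y : 'I_n.+1).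

(* Pairs and singletons are the orbits of an involution; taking it in 'S_n.+1
   lets a pair be added by multiplication with a transposition. *)
Definition matching g : {set {set 'I_n.+1}} := [set [set x; g x]%SET | x in 'I_n.+1].

Section Involution.
Context (g : 'S_n.+1) (gK : involutive g).

Lemma mem_set2_perm x y : y \in [set x; g x] -> [set y; g y] = [set x; g x].
Proof. by rewrite !inE => /orP[] /eqP -> //; rewrite gK finset.setUC. Qed.

Lemma paired_matching l m : paired (matching g) l m = (l != m) && (g l == m).
Proof.
rewrite /paired; apply: andb_id2l => lm; apply/imsetP/eqP => [[x _ lmE]|<-].
  have : l \in [set x; g x] by rewrite -lmE !inE eqxx.
  move/mem_set2_perm => xE; move: lmE; rewrite -xE => lmE.
  have : g l \in [set l; m] by rewrite lmE !inE eqxx orbT.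
  have : m \in [set l; g l] by rewrite -lmE !inE eqxx orbT.
  by rewrite !inE eq_sym (negPf lm) /= => /eqP ->.
by exists l.
Qed.

Lemma singleton_matching x : singleton (matching g) x = (g x == x).
Proof.
rewrite /singleton; apply/imsetP/eqP => [[y _ xE]|gx]; last first.
  by exists x => //; rewrite gx finset.setUid.
have : y \in [set x] by rewrite xE !inE eqxx.
have : g y \in [set x] by rewrite xE !inE eqxx orbT.
by rewrite !inE => /eqP gy /eqP yx; rewrite yx in gy.
Qed.

Lemma partition_matching : finset.partition (matching g) [set: 'I_n.+1].
Proof.
apply/and3P; split.
- rewrite /finset.cover; apply/eqP/setP => x; rewrite finset.in_setT; apply/bigcupP.
  by exists [set x; g x]; [apply: imset_f | rewrite !inE eqxx].
- apply/finset.trivIsetP => A B /imsetP[x _ ->] /imsetP[y _ ->]; apply: contraNT.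
  case/pred0Pn => z /andP[/= zx zy].
  by rewrite -(mem_set2_perm zx) -(mem_set2_perm zy).
- apply/imsetP => -[x _ /setP /(_ x)]; by rewrite !inE eqxx.
Qed.

Lemma pblock_matching x : finset.pblock (matching g) x = [set x; g x].
Proof.
apply: def_pblock; [by case/and3P: partition_matching|exact: imset_f|].
by rewrite !inE eqxx.
Qed.

Lemma height_matching x :
  height (matching g) x = if g x == x then n.+1 else (minn x (g x)).+1.
Proof.
rewrite /height singleton_matching; case: ifP => // _; congr _.+1.
case: arg_minnP => [|y]; rewrite pblock_matching !inE ?eqxx //.
move=> /orP[] /eqP -> min_y.
  by have := min_y (g x); rewrite !inE eqxx orbT => /(_ isT) /minn_idPl ->.
by have := min_y x; rewrite !inE eqxx => /(_ isT) /minn_idPr ->.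
Qed.

End Involution.

Lemma matching_inj g1 g2 : involutive g1 -> involutive g2 ->
  matching g1 = matching g2 -> g1 = g2.
Proof.
move=> g1K g2K eq12; apply/permP => x.
have /setP E := pblock_matching g1K x; move: E; rewrite eq12 pblock_matching // => E.
have := E (g1 x); have := E (g2 x); rewrite !inE !eqxx !orbT.
move=> /esym /orP[] /eqP g2x; last by rewrite g2x.
by rewrite g2x => /orP[] /eqP.
Qed.

Lemma matching_surj P : finset.partition P [set: 'I_n.+1] ->
  [forall b in P, #|b| <= 2]%N -> exists2 g : 'S_n.+1, involutive g & P = matching g.
Proof.
move=> partP /forall_inP P2; have /and3P[/eqP covP trivP P0] := partP.
have xP x : x \in finset.cover P by rewrite covP finset.in_setT.
(* The other element of the block of x, or x itself if the block is a singleton. *)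
pose f x := odflt x [pick y in finset.pblock P x | y != x].
have fE x : finset.pblock P x = [set x; f x].
  have bP : finset.pblock P x \in P by rewrite pblock_mem.
  have xb : x \in finset.pblock P x by rewrite mem_pblock.
  rewrite /f; case: pickP => [y /andP[yb yx]|none] /=.
    apply/esym/eqP; rewrite eqEcard finset.subUset !finset.sub1set xb yb cards2.
    by rewrite eq_sym yx P2.
  apply/setP => z; rewrite !inE orbb; apply/idP/eqP => [zb|-> //].
  by have := none z; rewrite zb /=; case: eqP.
have fK : involutive f.
  move=> x; have /(same_pblock trivP) : f x \in finset.pblock P x by rewrite fE !inE eqxx orbT.
  rewrite !fE => /setP E; have := E x; have := E (f (f x)).
  rewrite !inE eqxx /= orbT => /esym/orP[/eqP //|/eqP ffx].
  by rewrite ffx orbb eqxx => /eqP <-.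
exists (perm (inv_inj fK)); first by move=> x; rewrite !permE.
apply/setP => b; apply/idP/imsetP => [bP|[x _ ->]]; last first.
  by rewrite permE -fE pblock_mem.
have [b0|[x xb]] := set_0Vmem b; first by rewrite -b0 bP in P0.
by exists x => //; rewrite permE -fE (def_pblock trivP bP xb).
Qed.

End Matchings.

(** * Building the members of B(n+1) one pair at a time *)

Section PartialMatchings.
Context {n : nat}.
Local Open Scope set_scope.
Local Open Scope nat_scope.
Implicit Types (P : {set {set 'I_n.+1}}) (g : 'S_n.+1) (k l x y : 'I_n.+1) (m : nat).

(* The state after m steps of the construction of a member of B(n+1) with
   pi(0) = k: the vertices 0, .., m - 1 are matched, m, .., k - 1 are not yet. *)
Definition partial_matching k m g : bool :=
  [&& [forall x, g (g x) == x], g ord0 == k,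
      [forall l : 'I_n.+1, (0 < l < m) ==> (k < g l)],
      [forall x : 'I_n.+1, (k < x) ==> (g x == x) || (0 < g x < m)]
    & [forall x : 'I_n.+1, (m <= x < k) ==> (g x == x)]].

Lemma partial_matchingP k m g :
  reflect [/\ involutive g, g ord0 = k, forall l, 0 < l < m -> k < g l,
              forall x, k < x -> (g x == x) || (0 < g x < m)
            & forall x, m <= x < k -> g x = x]
          (partial_matching k m g).
Proof.
apply: (iffP and5P) => [[g1 /eqP g2 g3 g4 g5]|[g1 g2 g3 g4 g5]]; split => //.
- by move=> x; apply/eqP/(forallP g1).
- by move=> l; apply/implyP/(forallP g3).
- by move=> l; apply/implyP/(forallP g4).
- by move=> x xk; apply/eqP; move: xk; apply/implyP/(forallP g5).
- by apply/forallP => x; rewrite g1.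
- by rewrite g2.
- by apply/forallP => x; apply/implyP/g3.
- by apply/forallP => x; apply/implyP/g4.
- by apply/forallP => x; apply/implyP => /g5 ->.
Qed.

(** The completed construction is the case m = k, where the range m <= x < k of vertices still to be
    matched is empty. *)
Lemma Bpart_matching g : involutive g ->
  (matching g \in Bpart) = (0 < g ord0) && partial_matching (g ord0) (g ord0) g.
Proof.
move=> gK; rewrite inE partition_matching //=.
have -> /= : [forall b in matching g, #|b| <= 2].
  by apply/forall_inP => b /imsetP[x _ ->]; rewrite cards2; case: (_ != _).
apply/existsP/andP => [[k /and4P[k0 + /forallP k3 /forallP k4]]|[g0 /partial_matchingP[_ _ g3 g4 _]]].
  rewrite paired_matching // => /andP[_ /eqP gk]; rewrite gk; split=> //.
  apply/partial_matchingP; split => // [l lk|x xk|x]; last by rewrite leqNgt andNb.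
    have /existsP[y] := implyP (k3 l) lk.
    by rewrite paired_matching // => /and3P[ky _ /eqP ->].
  have /orP[|/existsP[l]] := implyP (k4 x) xk.
    by rewrite singleton_matching // => ->.
  rewrite paired_matching // => /and3P[lk _ /eqP lx].
  by rewrite -lx gK lk orbT.
exists (g ord0); rewrite g0 paired_matching // eqxx andbT /=; apply/and3P; split.
- by apply: contraTN g0 => /eqP <-.
- apply/forallP => l; apply/implyP => lk; apply/existsP; exists (g l).
  rewrite g3 //= paired_matching // eqxx andbT; apply/eqP => lg.
  by have := g3 _ lk; rewrite -lg ltnNge ltnW //; case/andP: lk.
- apply/forallP => x; apply/implyP => xk; rewrite singleton_matching //.
  have /orP[->//|gx] := g4 _ xk; apply/orP; right; apply/existsP; exists (g x).
  rewrite gx paired_matching // gK eqxx andbT /=; apply/eqP => E.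
  by case/andP: gx => _; rewrite E ltnNge (ltnW xk).
Qed.

Lemma big_Bpart (M : nmodType) (F : {set {set 'I_n.+1}} -> M) :
  (\sum_(P in Bpart) F P = \sum_(k : 'I_n.+1 | (0 < k)%N)
    \sum_(g | partial_matching k k g) F (matching g))%R.
Proof.
pose B := [set g : 'S_n.+1 | (0 < g ord0) && partial_matching (g ord0) (g ord0) g].
have BK g : g \in B -> involutive g by rewrite inE => /andP[_ /partial_matchingP[]].
have -> : Bpart = matching @: B.
  apply/setP => P; apply/idP/imsetP => [PB|[g gB ->]]; last first.
    by rewrite (Bpart_matching (BK g gB)); move: gB; rewrite inE => ->.
  have := PB; rewrite inE => /and3P[partP P2 _].
  have [g gK PE] := matching_surj partP P2.
  by exists g => //; rewrite inE -Bpart_matching // -PE.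
rewrite big_imset /=; last by move=> g1 g2 /BK g1K /BK g2K; apply: matching_inj.
rewrite (partition_big (fun g : 'S_n.+1 => g ord0) (fun k : 'I_n.+1 => 0 < k)) /=.
  apply: eq_bigr => k k0; apply: eq_bigl => g; rewrite inE.
  apply/idP/idP => [/andP[/andP[_ +] /eqP <-]//|gm].
  by case/partial_matchingP: (gm) => _ -> _ _ _; rewrite k0 gm eqxx.
by move=> g; rewrite inE => /andP[].
Qed.

Lemma big_paired (T : Type) (idx : T) (op : Monoid.com_law idx) g
    (F : 'I_n.+1 -> 'I_n.+1 -> T) : involutive g ->
  \big[op/idx]_(lr : 'I_n.+1 * 'I_n.+1 | (lr.1 < lr.2) && paired (matching g) lr.1 lr.2)
    F lr.1 lr.2 = \big[op/idx]_(l : 'I_n.+1 | l < g l) F l (g l).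
Proof.
move=> gK.
rewrite -(pair_big_dep xpredT (fun l r : 'I_n.+1 => (l < r) && paired (matching g) l r) F) /=.
rewrite [RHS]big_mkcond; apply: eq_bigr => l _.
rewrite (eq_bigl (fun r => (r == g l) && (l < r))) => [|r]; last first.
  rewrite paired_matching // andbC eq_sym; case: (ltnP l r) => lr; rewrite ?andbF //.
  by rewrite -val_eqE /= gtn_eqF //= !andbT eq_sym.
by rewrite big_mkcondr /= big_pred1_eq.
Qed.

Section FullMatching.
Context (k : 'I_n.+1) (g : 'S_n.+1) (k_gt0 : 0 < k) (gk : partial_matching k k g).

(** Below k a vertex is matched with k or higher; above k it is free or matched below k. So 0, .., k
    - 1 are the smaller elements of the pairs, which fixes all heights. *)
Lemma ltn_full_matching l : (l < g l) = (l < k).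
Proof.
case/partial_matchingP: gk => gK g0 g3 g4 _.
case: (ltngtP l k) => lk.
- have [l0|l0] := posnP l; first by rewrite (_ : l = ord0) ?g0 //; apply: val_inj.
  by rewrite (ltn_trans lk) // g3 ?l0.
- have /orP[/eqP ->|/andP[_ gl]] := g4 _ lk; first by rewrite ltnn.
  by apply/negbTE; rewrite -leqNgt (ltnW (ltn_trans gl lk)).
- by rewrite (val_inj lk) -g0 gK ltn0.
Qed.

Lemma partner0_full_matching : partner0 (matching g) = k.
Proof.
case/partial_matchingP: gk => gK g0 _ _ _.
rewrite /partner0; case: pickP => [x|/(_ k)].
  by rewrite paired_matching // g0 => /andP[_ /eqP <-].
by rewrite paired_matching // g0 eqxx andbT -val_eqE /= eq_sym -lt0n k_gt0.
Qed.

Lemma sum_ltn_ord_ltn m : m <= n.+1 -> \sum_(l < n.+1) (l < m) = m.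
Proof.
move=> mn; rewrite -(@big_mkcond _ _ _ _ _ (fun l : 'I_n.+1 => l < m) (fun=> 1)).
by rewrite -(big_ord_widen _ (fun=> 1)) // sum1_card card_ord.
Qed.

Lemma card_set_sum (p : pred 'I_n.+1) : #|[set x | p x]| = \sum_x p x.
Proof.
by rewrite -sum1_card big_mkcond; apply: eq_bigr => x _; rewrite inE; case: (p x).
Qed.

(** Heights increase with the smaller element, so the pair of l crosses every x with l < x < k: C(k,
    2) crossings in all. The vertex k has height 1 and is never counted. Above k, x counts if it is
    a singleton or its partner exceeds l; the pair of 0 ends at k and adds nothing there. *)
Lemma cross_full_matching :
  cross (matching g) = 'C(k, 2) + \sum_(l : 'I_n.+1 | 0 < l < k)
    #|[set x : 'I_n.+1 | (k < x < g l) && ((g x == x) || (l < g x))]|.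
Proof.
case/partial_matchingP: (gk) => gK g0 g3 g4 _.
rewrite /cross (big_paired _ (fun l r => #|[set x : 'I_n.+1 | (l < x < r)
                  && (height (matching g) l < height (matching g) x)]|)) //.
rewrite (eq_bigl _ _ ltn_full_matching).
rewrite (eq_bigr (fun l : 'I_n.+1 => \sum_(x < n.+1) (l < x < k) + (if 0 < l then
    #|[set x : 'I_n.+1 | (k < x < g l) && ((g x == x) || (l < g x))]| else 0))).
  rewrite big_split -big_mkcondr /=; congr (_ + _); last first.
    by apply: eq_bigl => l; rewrite andbC.
  rewrite big_mkcond (eq_bigr (fun l : 'I_n.+1 => \sum_(x < n.+1) (l < x < k))) /=.
    rewrite exchange_big /= -bin2_sum big_mkord (big_ord_widen _ id (ltnW (ltn_ord k))).
    rewrite [RHS]big_mkcond; apply: eq_bigr => x _ /=; case: ifP => xk.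
      under eq_bigr do rewrite andbT.
      by rewrite sum_ltn_ord_ltn // ltnW.
    by rewrite big1 // => l _; rewrite andbF.
  move=> l _; case: ifP => // lk; rewrite big1 // => x _.
  by case: andP => // -[/ltn_trans xl] /xl; rewrite lk.
move=> l lk; rewrite !card_set_sum.
have height_lt x : x < k -> height (matching g) x = x.+1.
  move=> xk; have xg : x < g x by rewrite ltn_full_matching.
  by rewrite height_matching // -val_eqE /= gtn_eqF // (minn_idPl (ltnW xg)).
have height_k : height (matching g) k = 1.
  by rewrite height_matching // -g0 gK -val_eqE /= ltn_eqF ?g0 // min0n.
rewrite height_lt //.
have [l0|l0] := posnP l.
  rewrite addn0; apply: eq_bigr => x _; rewrite l0 (_ : l = ord0) ?g0 //; last exact: val_inj.
  case: (ltnP x k) => xk; rewrite ?andbF // height_lt // andbT.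
  by rewrite ltnS andbb.
rewrite -big_split /=; apply: eq_bigr => x _.
have kgl : k < g l by rewrite g3 ?l0.
case: (ltngtP x k) => xk /=.
- by rewrite height_lt // andbT ltnS (ltn_trans xk kgl) andbT; case: (l < x).
- rewrite (ltn_trans lk xk) /= ?andbF ?add0n /=.
  rewrite height_matching //; case: eqP => gx; first by rewrite ltnS (leq_trans lk (ltn_ord k : k <= n)) orTb !andbT.
  have /orP[/eqP //|/andP[_ gxk]] := g4 _ xk.
  by rewrite ltnS (minn_idPr (ltnW (ltn_trans gxk xk))).
- by rewrite (val_inj xk) height_k !andbF.
Qed.

End FullMatching.
End PartialMatchings.

Section Swap.
Context {n : nat} (k : 'I_n.+1) (m : nat) (a x : 'I_n.+1).
Context (am : a = m :> nat) (a_gt0 : (0 < a)%N) (ak : (a < k)%N).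
Implicit Types (g : 'S_n.+1) (l y : 'I_n.+1).
Local Open Scope nat_scope.
Local Notation t := (tperm a x).

(** Both a and x are fixed by g, so multiplying by their transposition adds the pair {a, x} and
    changes nothing else. *)
Lemma swap_partial_matching g : k < x -> g x = x -> partial_matching k m g ->
  partial_matching k m.+1 (g * t)%g
  /\ forall y, (g * t)%g y = if y == a then x else if y == x then a else g y.
Proof.
move=> kx gx /partial_matchingP[gK g0 g3 g4 g5].
have ga : g a = a by rewrite g5 // ak am leqnn.
have ax : a < x by apply: ltn_trans kx.
have nax : (x == a) = false by rewrite -val_eqE /= gtn_eqF.
have hE y : (g * t)%g y = if y == a then x else if y == x then a else g y.
  rewrite permM; case: eqP => [->|/eqP ya]; first by rewrite ga tpermL.
  case: eqP => [->|/eqP yx]; first by rewrite gx tpermR.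
  by rewrite tpermD // eq_sym; [rewrite -ga|rewrite -gx]; rewrite (inj_eq perm_inj).
have small y : y < k -> (y == x) = false.
  by move=> yk; rewrite -val_eqE /= ltn_eqF // (ltn_trans yk).
have large y : k <= y -> (y == a) = false.
  by move=> yk; rewrite -val_eqE /= gtn_eqF // (leq_trans ak).
split=> //; apply/partial_matchingP; split.
- move=> y; rewrite !hE; case: (y =P a) => [->|/eqP ya]; first by rewrite nax eqxx.
  case: (y =P x) => [->|/eqP yx]; first by rewrite eqxx.
  have -> : (g y == a) = false by rewrite -ga (inj_eq perm_inj) (negPf ya).
  have -> : (g y == x) = false by rewrite -gx (inj_eq perm_inj) (negPf yx).
  exact: gK.
- rewrite hE g0 small; last by apply: leq_trans ak.
  by rewrite -val_eqE /= ltn_eqF.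
- move=> l /andP[l0]; rewrite ltnS leq_eqVlt => /orP[lm|lm].
    by rewrite hE -val_eqE /= am lm.
  rewrite hE small; last by rewrite (ltn_trans lm) // -am.
  by rewrite -val_eqE /= am ltn_eqF // g3 // l0.
- move=> y ky; rewrite hE large ?(ltnW ky) //.
  case: (y =P x) => [->|/eqP yx]; first by rewrite a_gt0 am ltnSn orbT.
  have /orP[->//|/andP[-> gm]] := g4 _ ky.
  by rewrite (ltn_trans gm) ?orbT.
- move=> y /andP[my yk]; rewrite hE small // -val_eqE /= gtn_eqF ?am //.
  by rewrite g5 // yk ltnW.
Qed.

(** The inverse step, with x recovered as the partner of a; both directions give the bijection
    behind [rannihs_matchings]. *)
Lemma unswap_partial_matching g : partial_matching k m.+1 g -> g a = x ->
  [/\ k < x, (g * t)%g x = x & partial_matching k m (g * t)%g].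
Proof.
move=> /partial_matchingP[gK g0 g3 g4 g5] ga.
have kx : k < x by rewrite -ga g3 // a_gt0 am ltnSn.
have gx : g x = a by rewrite -ga gK.
have ax : a < x by apply: ltn_trans kx.
have nax : (x == a) = false by rewrite -val_eqE /= gtn_eqF.
have hE y : (g * t)%g y = if y == a then a else if y == x then x else g y.
  rewrite permM; case: eqP => [->|/eqP ya]; first by rewrite ga tpermR.
  case: eqP => [->|/eqP yx]; first by rewrite gx tpermL.
  by rewrite tpermD // eq_sym; [rewrite -gx|rewrite -ga]; rewrite (inj_eq perm_inj).
have small y : y < k -> (y == x) = false.
  by move=> yk; rewrite -val_eqE /= ltn_eqF // (ltn_trans yk).
have large y : k <= y -> (y == a) = false.
  by move=> yk; rewrite -val_eqE /= gtn_eqF // (leq_trans ak).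
split=> //; first by rewrite hE nax eqxx.
apply/partial_matchingP; split.
- move=> y; rewrite !hE; case: (y =P a) => [->|/eqP ya]; first by rewrite eqxx.
  case: (y =P x) => [->|/eqP yx]; first by rewrite nax eqxx.
  have -> : (g y == a) = false by rewrite -gx (inj_eq perm_inj) (negPf yx).
  have -> : (g y == x) = false by rewrite -ga (inj_eq perm_inj) (negPf ya).
  exact: gK.
- rewrite hE g0 small; last by apply: leq_trans ak.
  by rewrite -val_eqE /= ltn_eqF.
- move=> l /andP[l0 lm]; rewrite hE small; last by rewrite (ltn_trans lm) // -am.
  by rewrite -val_eqE /= am ltn_eqF // g3 // l0 ltnW.
- move=> y ky; rewrite hE large ?(ltnW ky) //.
  case: (y =P x) => [->|/eqP yx]; first by rewrite eqxx.
  have /orP[->//|/andP[-> gm]] := g4 _ ky.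
  move: gm; rewrite ltnS leq_eqVlt => /orP[gm|->]; last by rewrite orbT.
  have : g y == a by rewrite -val_eqE /= am.
  by rewrite -gx (inj_eq perm_inj) (negPf yx).
- move=> y /andP[my yk]; rewrite hE small //; case: (y =P a) => [->//|/eqP ya].
  apply: g5; rewrite yk andbT ltn_neqAle my andbT -am.
  by rewrite eq_sym; move: ya; rewrite -val_eqE.
Qed.

End Swap.

Section Base.
Context {n : nat} (k : 'I_n.+1).

Lemma partial_matching1 (g : 'S_n.+1) : (0 < k)%N ->
  partial_matching k 1 g = (g == tperm ord0 k).
Proof.
move=> k0; apply/partial_matchingP/eqP => [[gK g0 _ g4 g5]|->].
  apply/permP => y; case: tpermP => [->|->|/eqP y0 /eqP yk]; rewrite ?g0 // -?g0 ?gK //.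
  case: (ltngtP y k) => ky; last by rewrite (val_inj ky) eqxx in yk.
    by apply: g5; rewrite ky andbT lt0n; move: y0; rewrite -val_eqE.
  have /orP[/eqP //|/andP[gy]] := g4 _ ky.
  by rewrite ltnS leqNgt gy.
split.
- exact: tpermK.
- exact: tpermL.
- by case=> [[|[]]].
- move=> y ky; rewrite tpermD ?eqxx // -val_eqE /= ltn_eqF //; exact: leq_ltn_trans ky.
- move=> y /andP[y0 yk]; rewrite tpermD //; first by rewrite -val_eqE /= ltn_eqF.
  by rewrite -val_eqE /= gtn_eqF.
Qed.

End Base.

(** * Products of right annihilations as sums over partial matchings *)

Section Expansion.
Context {R : realType} {d n : nat} (q : R[i]) (f : nat -> 'I_d).
Local Notation fk := (fock R d).
Local Notation V := 'I_n.+1.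
Local Notation letters := (map (fun x : V => f x)).
Implicit Types (k x y l : V) (b : 'I_d) (s : seq V) (g : 'S_n.+1) (m : nat).

(** Indexing the word by a decreasing list of vertices makes the letters to the right of x those of
    smaller vertices, and a removal is a filter even when letters repeat. *)
Lemma rannih_map b s : sorted (fun x y : V => (y < x)%N) s ->
  rannih q b (fock_e (letters s)) =
  \sum_(x <- s) ((f x == b)%:R * q ^+ count (fun y : V => (y < x)%N) s)
    *: fock_e (letters [seq y <- s | y != x]) :> fk.
Proof.
rewrite rannih_e; elim: s => [|a s IH] /=; first by rewrite big_nil.
rewrite path_sortedE; last by move=> y x z yx /ltn_trans; apply.
case/andP => /allP as_ /IH {}IH; rewrite big_cons IH ltnn eqxx /= add0n.
have a_s : all (fun y => y != a) s.
  by apply/allP => x /as_ xa /=; rewrite -val_eqE /= ltn_eqF.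
rewrite size_map (all_filterP a_s); congr (_ + _).
  have /eqP -> // : count (fun y : V => (y < a)%N) s == size s.
  by rewrite -all_count; apply/allP.
rewrite linear_sum /= big_seq [RHS]big_seq; apply: eq_bigr => x /[dup] xs /as_ xa.
rewrite linearZ /= lcreate_e ltnNge (ltnW xa) /= add0n.
by have -> : a != x by rewrite -val_eqE /= gtn_eqF.
Qed.

Definition free_above k g : seq V := [seq x : V <- rev (enum V) | (k < x)%N && (g x == x)].

Lemma free_above_sorted k g : sorted (fun x y : V => (y < x)%N) (free_above k g).
Proof.
apply: sorted_filter; first by move=> y x z yx /ltn_trans; apply.
by have := iota_ltn_sorted 0 n.+1; rewrite rev_sorted -val_enum_ord sorted_map.
Qed.

(** At m = k this is the part of the delta and of q^cross due to the pairs other than {0, k},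
    without the crossings below k. *)
Definition matching_weight k m g : R[i] := \prod_(l : V | (0 < l < m)%N)
  ((f l == f (g l))%:R * q ^+
   #|[set x : V | (k < x < g l)%N && ((g x == x) || (l < g x)%N)]%SET|).

(** The new pair crosses the free vertices between k and x, as no vertex above k has a partner
    beyond a yet. The older factors persist: where they counted x as free, they now count it because
    its partner a exceeds l. *)
Lemma matching_weight_swap k (a x : V) g : (0 < a < k)%N -> (k < x)%N -> g x = x ->
  partial_matching k a g ->
  matching_weight k a.+1 (g * tperm a x)%g =
  (f x == f a)%:R * q ^+ count (fun y : V => (y < x)%N) (free_above k g)
  * matching_weight k a g.
Proof.
move=> /andP[a0 ak] kx gx pg.
have [pgt hE] := swap_partial_matching (erefl (a : nat)) a0 ak kx gx pg.
have [gK g0 g3 g4 g5] := partial_matchingP _ _ _ pg.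
have large y : (k < y)%N -> (y == a) = false.
  by move=> yk; rewrite -val_eqE /= gtn_eqF // (ltn_trans ak).
rewrite /matching_weight (bigD1 a) ?a0 ?ltnSn //=; congr (_ * _).
  rewrite hE eqxx eq_sym; congr (_ * q ^+ _).
  rewrite count_filter count_rev -sum1_card -sum1_count big_enum_cond /=.
  apply: eq_bigl => y; rewrite inE [RHS]andbC [RHS]andbAC; apply: andb_id2l => /andP[ky yx].
  have -> : (g * tperm a x)%g y = g y by rewrite hE large // -val_eqE /= ltn_eqF.
  by have /orP[/eqP ->|/andP[_ /ltnW]] := g4 _ ky; rewrite ?eqxx // leqNgt => /negPf ->; rewrite orbF.
apply: eq_big => [l|l /andP[/andP[l0 la] nla]].
  by rewrite -andbA ltnS (ltn_neqAle l a) -val_eqE /= [(l <= a)%N && _]andbC.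
have lx : (l == x) = false.
  by rewrite -val_eqE /= ltn_eqF // (ltn_trans (leq_ltn_trans (la : l <= a)%N ak) kx).
rewrite hE (negPf nla) lx; congr (_ * q ^+ _); apply: eq_card => y; rewrite !inE.
apply: andb_id2l => /andP[ky _]; rewrite hE large //.
case: (y =P x) => [->|//]; rewrite gx eqxx /=.
have al : (l < a)%N by rewrite ltn_neqAle -ltnS la andbT.
by rewrite al orbT.
Qed.

Lemma free_above_swap k (a x : V) g : (0 < a < k)%N -> (k < x)%N -> g x = x ->
  partial_matching k a g ->
  free_above k (g * tperm a x)%g = [seq y <- free_above k g | y != x].
Proof.
move=> /andP[a0 ak] kx gx pg.
have [_ hE] := swap_partial_matching (erefl (a : nat)) a0 ak kx gx pg.
rewrite /free_above -filter_predI; apply: eq_filter => y /=.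
rewrite andbCA; apply: andb_id2l => ky; rewrite hE.
have -> : (y == a) = false by rewrite -val_eqE /= gtn_eqF // (ltn_trans ak).
case: (y =P x) => [->|//]; by rewrite -val_eqE /= ltn_eqF // (ltn_trans ak).
Qed.

Fixpoint descending_word m : seq 'I_d :=
  if m is m'.+1 then f m :: descending_word m' else [::].

(** Vertex 1 is matched first, since its factor acts first; each further factor matches the next
    vertex with every free vertex above k in turn. *)
Lemma rannihs_matchings k m : (m < k)%N ->
  rannihs q (descending_word m)
    (fock_e (letters [seq x : V <- rev (enum V) | (k < x)%N])) =
  \sum_(g | partial_matching k m.+1 g)
    matching_weight k m.+1 g *: fock_e (letters (free_above k g)) :> fk.
Proof.
elim: m => [|m IH] mk.
  rewrite (big_pred1 (tperm ord0 k)) => [|g]; last exact: partial_matching1.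
  rewrite /matching_weight big_pred0 ?scale1r => [|l]; last by case: (val l) => [|[]].
  congr (fock_e (map _ _)); apply: eq_filter => x.
  case: ltnP => // kx; rewrite tpermD ?eqxx // -val_eqE /= ltn_eqF //.
  exact: leq_ltn_trans kx.
have an : (m.+1 < n.+1)%N := ltn_trans mk (ltn_ord k).
pose a : V := Ordinal an.
rewrite [LHS]/= IH ?(ltnW mk) // linear_sum /=.
under eq_bigr => g _ do rewrite linearZ /= (rannih_map _ (free_above_sorted k g)).
transitivity (\sum_(g | partial_matching k m.+1 g)
  \sum_(x : V | (k < x)%N && (g x == x)) matching_weight k m.+2 (g * tperm a x)%g *:
    fock_e (letters (free_above k (g * tperm a x)%g)) : fk).
  apply: eq_bigr => g pg.
  rewrite big_uniq ?filter_uniq ?rev_uniq ?enum_uniq //= scaler_sumr.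
  apply: eq_big => [x|x]; first by rewrite mem_filter mem_rev mem_enum andbT.
  rewrite mem_filter => /andP[/andP[kx /eqP gx] _].
  by rewrite (@free_above_swap k a) // (@matching_weight_swap k a) // scalerA mulrC.
rewrite (exchange_big_dep xpredT) //=.
(* The right side is grouped by the partner x of the new vertex [a]; multiplying by the
   transposition undoes the last step. *)
rewrite [RHS](partition_big (fun g : 'S_n.+1 => g a) xpredT) //=.
apply: eq_bigr => x _.
rewrite [RHS](reindex_inj (mulIg (tperm a x))) /=; apply: eq_bigl => g.
apply/idP/idP => [/and3P[pg kx /eqP gx]|/andP[pg /eqP gx]].
  have [-> ->] := @swap_partial_matching _ k m.+1 a x erefl isT mk g kx gx pg.
  by rewrite !eqxx.
have [] := @unswap_partial_matching _ k m.+1 a x erefl isT mk _ pg gx.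
by rewrite -mulgA tperm2 mulg1 => -> -> ->; rewrite eqxx.
Qed.

End Expansion.

(** * The operator D as a sum over factorizations *)

Section SplitExpansion.
Context {R : realType} {d : nat}.
Local Notation fk := (fock R d).
Implicit Types (i : 'I_d) (w u : seq 'I_d).

Lemma split_sum_e (q : R[i]) i w u : split_sum q i w (fock_e u) =
  \sum_(p < size w) ((nth i w p == i)%:R * split_weight q (size w - p.+1))
    *: rannihs q (drop p.+1 w) (fock_e (u ++ take p w)) :> fk.
Proof.
elim: w u => [|a w IH] u /=; first by rewrite big_ord0.
rewrite big_ord_recl /= subSS subn0 drop0 cats0 rcreate_e IH; congr (_ + _).
by apply: eq_bigr => p _; rewrite -cats1 -catA /= subSS.
Qed.

Lemma letterS i w (x : nat) : (x < size w)%N ->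
  letter i w x.+1 = nth i w (size w - x.+1).
Proof. by move=> xw; rewrite /letter /= nth_rev. Qed.

Lemma descending_word_letter i w m : (m <= size w)%N ->
  descending_word (letter i w) m = drop (size w - m) w.
Proof.
elim: m => [|m IH] mw /=; first by rewrite subn0 drop_size.
by rewrite letterS // IH 1?ltnW // [RHS](drop_nth i) ?ltn_subrL ?(leq_ltn_trans _ mw) // -subSn.
Qed.

Lemma filter_iota_gtn (k n : nat) : (k <= n)%N ->
  [seq x <- iota 0 n.+1 | (k < x)%N] = iota k.+1 (n - k).
Proof.
move=> kn; rewrite -{1}(subnKC (kn : k.+1 <= n.+1)%N) subSS iotaD filter_cat add0n.
rewrite (eq_in_filter (a2 := pred0)) ?filter_pred0 => [|x]; last first.
  by rewrite mem_iota add0n /= ltnS leqNgt => /negPf.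
by apply/all_filterP/allP => x; rewrite mem_iota; case/andP.
Qed.

(** Vertex x sits at index |w| - x, so the vertices above k carry the first |w| - k letters. *)
Lemma ascending_take i w (k : 'I_(size w).+1) :
  [seq letter i w x | x : 'I_(size w).+1 <- [seq x : 'I_(size w).+1 <- rev (enum 'I_(size w).+1) | (k < x)%N]]
  = take (size w - k) w.
Proof.
rewrite filter_rev map_rev (map_comp (letter i w) val) -filter_map val_enum_ord.
have kw : (k <= size w)%N by rewrite -ltnS.
rewrite filter_iota_gtn // map_nth_iota /= ?size_rev ?addSn ?subnKC //.
by rewrite drop_rev take_oversize ?revK // size_rev size_takel ?leq_subr.
Qed.

(** Every vertex up to k is matched, so all singletons lie above k. *)
Lemma singleton_word_matching i w (k : 'I_(size w).+1) (g : 'S_(size w).+1) :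
  (0 < k)%N -> partial_matching k k g ->
  singleton_word i (matching g) = [seq letter i w x | x : 'I_(size w).+1 <- free_above k g].
Proof.
move=> k0 gk; have [gK g0 _ _ _] := partial_matchingP _ _ _ gk.
rewrite /singleton_word -map_rev -filter_rev; congr (map _ _).
apply: eq_filter => x; rewrite singleton_matching //; case: eqP => gx; rewrite ?andbF // andbT.
have := ltn_full_matching k0 gk x; rewrite gx ltnn => /esym/negbT; rewrite -leqNgt.
rewrite leq_eqVlt => /orP[/eqP /val_inj kx|-> //].
by have := gK ord0; rewrite g0 kx gx -kx => kE; rewrite kE in k0.
Qed.

Lemma delta_pairs_matching i w (k : 'I_(size w).+1) (g : 'S_(size w).+1) :
  (0 < k)%N -> partial_matching k k g ->
  delta_pairs i (matching g) = (letter i w k == i)%:R *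
    \prod_(l : 'I_(size w).+1 | (0 < l < k)%N) (letter i w l == letter i w (g l))%:R :> R[i].
Proof.
move=> k0 gk; have [gK g0 _ _ _] := partial_matchingP _ _ _ gk.
rewrite /delta_pairs.
rewrite (big_paired _ (fun l r => (letter i w l == letter i w r)%:R)) //=.
rewrite (eq_bigl _ _ (ltn_full_matching k0 gk)) (bigD1 ord0) //= g0 eq_sym.
congr (_ * _); apply: eq_bigl => l.
by rewrite andbC lt0n -val_eqE.
Qed.

(** B(1) is empty, since 0 has no vertex to be paired with; the empty word thus obeys the general
    formula. *)
Lemma D_basis_sum (q : R) i w : D_basis q i w =
  \sum_(P in @Bpart (size w))
    ((-1) ^+ (partner0 P).-1 * q%:C ^+ cross P * delta_pairs i P)
      *: fock_e (singleton_word i P).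
Proof.
by case: w => //; rewrite big_Bpart big_pred0 // => -[[|k] //].
Qed.

Lemma big_positive_ord (M : nmodType) n (F : 'I_n.+1 -> M) :
  \sum_(k : 'I_n.+1 | (0 < k)%N) F k = \sum_(p < n) F (fintype.lift ord0 (rev_ord p)).
Proof.
by rewrite big_mkcond big_ord_recl /= add0r (reindex_inj rev_ord_inj).
Qed.

(** The factorization with i at position p collects the partitions with k = |w| - p. As |v| = k - 1,
    [split_weight] carries the sign and the C(k, 2) crossings below k; [matching_weight] carries the
    rest. *)
Lemma D_basisE (q : R) i w : D_basis q i w = split_sum q%:C i w (fock_e [::]).
Proof.
rewrite D_basis_sum split_sum_e big_Bpart big_positive_ord; apply: eq_bigr => p _.
set k : 'I_(size w).+1 := fintype.lift ord0 (rev_ord p).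
have kE : k = (size w - p.+1).+1 :> nat by [].
have k0 : (0 < k)%N by rewrite kE.
have kw : (size w - p.+1 < size w)%N by rewrite ltn_subrL (leq_ltn_trans _ (ltn_ord p)).
have pE : (size w - k)%N = p by rewrite kE subnSK // subKn // ltnW.
have -> : drop p.+1 w = descending_word (letter i w) (size w - p.+1).
  by rewrite descending_word_letter ?leq_subr // subKn.
have -> : nth i w p = letter i w k by rewrite kE letterS // -kE pE.
have asc := ascending_take i k; rewrite pE in asc.
rewrite cat0s -asc rannihs_matchings ?kE //.
rewrite scaler_sumr -kE; apply: eq_bigr => g gk.
rewrite scalerA (singleton_word_matching i k0 gk) (partner0_full_matching k0 gk).
rewrite (cross_full_matching k0 gk) (delta_pairs_matching i k0 gk); congr (_ *: _).
have -> : matching_weight q%:C (letter i w) k k g =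
    (\prod_(l : 'I_(size w).+1 | (0 < l < k)%N) (letter i w l == letter i w (g l))%:R)
    * q%:C ^+ \sum_(l : 'I_(size w).+1 | (0 < l < k)%N)
      #|[set x : 'I_(size w).+1 | (k < x < g l)%N && ((g x == x) || (l < g x)%N)]%SET|.
  by rewrite /matching_weight big_split prodrXr.
have -> : k.-1 = (size w - p.+1)%N by rewrite kE.
rewrite /split_weight -[(size w - p.+1).+1]kE [q%:C ^+ (_ + _)]exprD; ring.
Qed.

End SplitExpansion.

(** * The commutation relation *)

Section Commutator.
Context {R : realType} {d : nat} (q : R).
Local Notation fk := (fock R d).
Implicit Types (i j : 'I_d) (w : seq 'I_d) (xi : fk).

Lemma D_commutator i j xi :
  D q i (lannih q%:C j xi + lcreate j xi)
  = lannih q%:C j (D q i xi) + lcreate j (D q i xi)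
    + (i == j)%:R *: (coeff [::] xi *: fock_e [::]).
Proof.
(* P^(0) on F_alg as a linear map, so that the identity can be checked on words. *)
pose vac : {linear fk -> fk} := fglift (fun w => (w == [::])%:R *: fock_e [::]).
have -> : coeff [::] xi *: fock_e [::] = vac xi.
  rewrite [in RHS](fock_sumE xi) linear_sum [in LHS](fock_sumE xi) raddf_sum scaler_suml.
  apply: eq_bigr => w _.
  by rewrite linearZ /= coeffZ coeffU mul1r fglift_e scalerA.
pose a : {linear fk -> fk} := lannih q%:C j \+ lcreate j.
apply: (@fock_linear_ext _ _ _ (fglift (D_basis q i) \o a)
  ((a \o fglift (D_basis q i)) \+ (i == j)%:R \*: vac)) => w /=.
rewrite linearD /= fglift_lannih lcreate_e !fglift_e !D_basisE /=.
rewrite rannihs0 rcreate_e.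
have := split_sum_commutator q%:C i j w (fock_e [::]).
rewrite lannih0 linear0 add0r qnumber0 lcreate_e => <-.
rewrite (@eq_rm_sum _ _ _ _ _ _ (fun v => split_sum q%:C i v (fock_e [::]))) => [|v _]; last exact: D_basisE.
rewrite -addrA; congr (_ + _); rewrite addrC; congr (_ + _).
(* Only the factorization of jw with u empty is left: R_w e_0 vanishes unless w is empty, and then
   the weight is 1. *)
rewrite !scalerA eq_sym; case: w => [|b w] /=; last by rewrite !mulr0.
by rewrite /split_weight /= !mulr1.
Qed.

End Commutator.

(** * Passage to the completion *)

Section Completion.
Context {R : realType} {F : completeNormedModType R[i]} (dot : {dot F for Num.conj}).

(* By Pythagoras, the ball of radius |z| around z contains no y orthogonal to z. *)
Lemma dense_orthogonal_eq0 (S : set F) (z : F) :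
  induces_norm dot -> dense S -> (forall y, S y -> dot z y = 0) -> z = 0.
Proof.
move=> hdot dS zS; apply/eqP; apply: contraT => z0.
have nz : 0 < `|z| by rewrite normr_gt0.
have [y [/= zy Sy]] := dS (ball z `|z|) (ex_intro _ z (ballxx z nz)) (ball_open z `|z|).
have : `|z - y| ^+ 2 < `|z| ^+ 2.
  by rewrite ltrXn2r ?normr_ge0 //; move: zy; rewrite -ball_normE.
rewrite !hdot dnormB [dot z y]zS // rmorph0 addr0 subr0 gtrDl -hdot.
by move=> /lt_geF; rewrite exprn_ge0.
Qed.

End Completion.

Theorem proposition4p5 (R : realType) (d : nat) (q : R) (hq : -1 < q < 1)
  (F : completeNormedModType R[i]) (dot : {dot F for Num.conj})
  (hdot : induces_norm dot)
  (iota : {linear fock R d -> F}) (hF : is_completion q dot iota)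
  (lstar l : 'I_d -> F -> F)
  (hlstar : forall i, is_creation iota i (lstar i))
  (hl : forall i, is_adjoint dot (lstar i) (l i))
  (A : 'I_d -> F -> F) (hA : forall i x, A i x = l i x + lstar i x)
  (P0 : F -> F)
  (hP0 : is_orthogonal_projection dot (line (iota (fock_e [::]))) P0) :
  forall (i j : 'I_d) (xi : fock R d),
    exists2 eta : fock R d, A j (iota xi) = iota eta &
      iota (D q i eta) - A j (iota (D q i xi)) = (i == j)%:R *: P0 (iota xi).
Proof.
case: hF => iota_inj dot_iota iota_dense i j xi.
have creation y : lstar j (iota y) = iota (lcreate j y).
  have [lin _ lstar_e] := hlstar j.
  pose c : {linear F -> F} :=
    HB.pack (lstar j) (GRing.isLinear.Build R[i] F F *:%R (lstar j) lin).
  apply: (@fock_linear_ext _ _ _ (c \o iota) (iota \o lcreate j)) => w /=.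
  by rewrite lstar_e lcreate_e.
(* The adjoint is determined by density: the two sides differ by a vector orthogonal to the dense
   range of [iota]. *)
have annihilation y : l j (iota y) = iota (lannih q%:C j y).
  apply/eqP; rewrite -subr_eq0; apply/eqP.
  apply: (@dense_orthogonal_eq0 R F dot (range iota)) => // _ [y' _ <-].
  by rewrite linearBl /= hl creation !dot_iota q_dot_lannih subrr.
have field y : A j (iota y) = iota (lannih q%:C j y + lcreate j y).
  by rewrite hA annihilation creation linearD.
exists (lannih q%:C j xi + lcreate j xi) => //.
rewrite field D_commutator linearD addrC addKr linearZ; congr (_ *: _).
(* The projection is c e_0 for some scalar c; testing orthogonality against e_0 itself, the scalar 1
   in [line], identifies c with the coefficient of xi at the empty word. *)
have [[c _ cE] orth] := hP0 (iota xi).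
have := orth _ (ex_intro2 _ _ 1 I (scale1r _)).
rewrite -cE -!linearZ /= -linearB dot_iota q_dot_e0 coeffB coeffZ coeffU eqxx !mulr1.
by move=> /eqP; rewrite subr_eq0 => /eqP ->.
Qed.
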